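(* Let $n\ge 1$, $X=\{x_1,\dots,x_n\}$, and let $\mathcal H=(\mathbb N_{-\infty},\vee,\star,-\infty)$ be the height algebra. Then: (1) Every labelled rooted binary tree $T$ over $X$ induces a max-plus linear operation $u\mapsto\max_{1\le i\le n}(u_i+d_i(T))$. Its $i$th coefficient $d_i(T)$ is the greatest depth at which $x_i$ occurs in $T$, with coefficient $-\infty$ when $x_i$ does not occur. Two labelled trees induce the same operation if and only if these coefficient vectors agree. (2) A vector $d=(d_1,\dots,d_n)\in\mathbb N_{-\infty}^n$ occurs as the coefficient vector of a single labelled tree if and only if $\sum_{i=1}^n 2^{-d_i}\le 1$, where the summand is interpreted as $0$ when $d_i=-\infty$. Such a vector has a realization by a labelled tree with an internal root if and only if none of its coordinates is zero. (3) Every vector in $\mathbb N_{-\infty}^n$ is the coefficient vector of a finite join of labelled trees. The algebra of $n$-variable term operations of $\mathcal H$ is naturally isomorphic to $\mathcal H^n$. This is the free algebra on $n$ generators in the variety $\mathsf V(\mathcal H)$ generated by $\mathcal H$. Under finite-language semantics, the empty language supplies an absorbing zero (the element $\mathbf 0$ of the empty-language completion $(\mathcal H^n)^{\varnothing}$), while a unital completion (such as $\widehat{\mathcal H}$) requires a distinct algebraic unit $\varepsilon$, interpreted heuristically as an empty-tree state. (4) Among terms in which each variable occurs exactly once (full-linear terms), distinct bracketings in a fixed variable order induce distinct operations. If variable permutations are also allowed, the number of induced operations is the number of ordered representations of $1$ as a sum of $n$ negative powers of $2$, that is, the number of tuples $(d_1,\dots,d_n)\in\mathbb N^n$ with $\sum_{i=1}^n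 2^{-d_i}=1$.
   Context: $\mathbb N=\{0,1,2,\dots\}$ and $\mathbb N_{-\infty}=\mathbb N\cup\{-\infty\}$, with $-\infty<k$ for all $k\in\mathbb N$ and $-\infty+a=a+(-\infty)=-\infty$ for every $a\in\mathbb N_{-\infty}$. The height algebra is $\mathcal H=(\mathbb N_{-\infty},\vee,\star,-\infty)$ with $a\vee b=\max\{a,b\}$, $a\star b=\max\{a,b\}+1$, and named constant $-\infty$. The power $\mathcal H^n$ carries the coordinatewise operations and constant. A rooted binary tree is a finite rooted tree in which every vertex has either zero or two children (children unordered); the depth of a leaf is its graph distance from the root. A labelled tree over $X$ is such a tree in which each leaf carries an element of $X$ or the silent label $-\infty$; labelled trees are taken up to rooted isomorphism preserving leaf labels. The grafting $S\circ T$ adjoins a new root whose two children are the roots of $S$ and $T$. For $u\in\mathbb N_{-\infty}^n$, evaluation is defined recursively by $[\![x_i]\!](u)=u_i$, $[\![-\infty]\!](u)=-\infty$ for one-leaf trees, and $[\![S\circ R]\!](u)=[\![S]\!](u)\star[\![R]\!](u)$; the operation induced by $T$ is $u\mapsto[\![T]\!](u)$. The coefficient vector (depth profile) of $T$ is $d(T)=(d_1(T),\dots,d_n(T))$. A finite join of labelled trees $T_1,\dots,T_k$ ($k\ge1$) induces $u\mapsto\max_j[\![T_j]\!](u)$, and its coefficient vector is the coordinatewise maximum of $d(T_1),\dots,d(T_k)$. An $n$-variable term operation of $\mathcal H$ is an operation $\mathcal H^n\to\mathcal H$ obtained by evaluating a term in $x_1,\dots,x_n$ in the signature $(\vee,\star,-\infty)$;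 the term operations form an algebra under pointwise $\vee$ and $\star$ with the constant operation $-\infty$. The natural isomorphism sends a term operation $u\mapsto\max_i(u_i+d_i)$ to its coefficient vector $d$. $\mathsf V(\mathcal H)$ is the class of all algebras in this signature satisfying every identity valid in $\mathcal H$. Finite-language semantics: a finite tree language is a finite, possibly empty, set of labelled trees over $X$, with join $L\vee M=L\cup M$ and pairwise grafting $L\circ M=\{S\circ T:S\in L,\ T\in M\}$. A nonempty language $L$ has profile $D(L)$, the coordinatewise maximum of $d(T)$ over $T\in L$. The empty-language completion $(\mathcal H^n)^{\varnothing}=\{\mathbf 0\}\sqcup\mathcal H^n$ adjoins to $\mathcal H^n$, with its operations $\vee$ and $\star$, one new element $\mathbf 0$ that is least for $\vee$ and absorbing for $\star$ ($\mathbf 0\star a=a\star\mathbf 0=\mathbf 0$ for all $a$); the profile map is extended by sending the empty language to $\mathbf 0$. Unital and zero-absorbing completion: $\widehat{\mathcal H}=(\{\bot,\varepsilon\}\sqcup\mathbb N_{-\infty},\vee,\odot,\bot,\varepsilon)$, where $\vee$ is maximum in the chain $\bot<\varepsilon<-\infty<0<1<2<\cdots$, and $\odot$ is given by $\bot\odot x=x\odot\bot=\bot$ for all $x$, $\varepsilon\odot x=x\odot\varepsilon=x$ for $x\neq\bot$, and $a\odot b=a\star b$ for $a,b\in\mathbb N_{-\infty}$. The unit $\varepsilon$ is distinct both from the absorbing state $\bot$ (no tree) and from $-\infty$ (the all-silent tree); it is only heuristically an ''empty tree'' and is not an actual labelled tree. A full-linear term is a term built using $\star$ alone whose leaves are labelled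 bijectively by $X$, so that each variable occurs exactly once and no constant occurs. *)

(* Defs.v *)
From HB Require Import structures.
From mathcomp Require Import all_boot all_order all_algebra.
From mathcomp Require Import finmap.
From mathcomp Require Import generic_quotient.
From mathcomp Require Import boolp classical_sets functions cardinality.
Set Implicit Arguments.
Unset Strict Implicit.
Unset Printing Implicit Defensive.
Import GRing.Theory.

(* [None] is the element -oo. *)
Definition height := option nat.

Definition hmax (a b : height) : height :=
  match a, b with
  | Some i, Some j => Some (maxn i j)
  | Some i, None => Some i
  | None, _ => b
  end.

Definition hadd (a b : height) : height :=
  match a, b with
  | Some i, Some j => Some (i + j)%N
  | _, _ => None
  end.

Definition hstar (a b : height) : height := hadd (hmax a b) (Some 1%N).

(* Two operations only: the empty-language completion and the algebra of
   finite tree languages have no named constant for -oo. *)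
Record bimagma := Bimagma {
  bcarrier :> Type;
  join : bcarrier -> bcarrier -> bcarrier;
  star : bcarrier -> bcarrier -> bcarrier }.

Record alg := Alg { abase :> bimagma; const : abase }.

Definition bihom (A B : bimagma) (f : A -> B) : Prop :=
  (forall x y, f (join x y) = join (f x) (f y)) /\
  (forall x y, f (star x y) = star (f x) (f y)).

Definition alg_hom (A B : alg) (f : A -> B) : Prop :=
  bihom f /\ f (const A) = const B.

Definition Halg : alg := @Alg (Bimagma hmax hstar) None.

Definition power (A : alg) (n : nat) : alg :=
  @Alg (@Bimagma {ffun 'I_n -> A}
          (fun u v => [ffun i => join (u i) (v i)])
          (fun u v => [ffun i => star (u i) (v i)]))
       [ffun=> const A].

Inductive term (V : Type) :=
| Var of V
| Const
| Join of term V & term V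
| Star of term V & term V.
Arguments Const {V}.

Fixpoint eval_term (A : alg) (V : Type) (v : V -> A) (t : term V) : A :=
  match t with
  | Var x => v x
  | Const => const A
  | Join s t => join (eval_term v s) (eval_term v t)
  | Star s t => star (eval_term v s) (eval_term v t)
  end.

Definition satisfies (A : alg) (s t : term nat) : Prop :=
  forall v : nat -> A, eval_term v s = eval_term v t.

Definition variety (A : alg) : alg -> Prop :=
  fun B => forall s t : term nat, satisfies A s t -> satisfies B s t.

Definition free_in (K : alg -> Prop) (I : Type) (F : alg) (g : I -> F) : Prop :=
  K F /\
  forall (A : alg), K A -> forall a : I -> A,
    exists! phi : F -> A, alg_hom phi /\ forall i, phi (g i) = a i.

Section Trees.

Variable n : nat.

Definition lin (d u : power Halg n) : Halg :=
  \big[hmax/None]_(i < n) hadd (u i) (d i).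

(* Plane representatives of labelled trees; the label [None] is silent. *)
Inductive ptree :=
| Leaf of option 'I_n
| Node of ptree & ptree.

Fixpoint ptree_enc (t : ptree) : GenTree.tree (option 'I_n) :=
  match t with
  | Leaf l => GenTree.Leaf l
  | Node s t => GenTree.Node 0 [:: ptree_enc s; ptree_enc t]
  end.

Fixpoint ptree_dec (t : GenTree.tree (option 'I_n)) : option ptree :=
  match t with
  | GenTree.Leaf l => Some (Leaf l)
  | GenTree.Node 0 [:: s; t] =>
      if ptree_dec s is Some s' then
        if ptree_dec t is Some t' then Some (Node s' t') else None
      else None
  | _ => None
  end.

Lemma ptree_encK : pcancel ptree_enc ptree_dec.
Proof. by elim=> [l //|s /= -> t ->]. Qed.

HB.instance Definition _ := Countable.copy ptree (pcan_type ptree_encK).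

Fixpoint piso (s t : ptree) : bool :=
  match s, t with
  | Leaf a, Leaf b => a == b
  | Node s1 s2, Node t1 t2 =>
      (piso s1 t1 && piso s2 t2) || (piso s1 t2 && piso s2 t1)
  | _, _ => false
  end.

Lemma piso_refl : reflexive piso.
Proof. by elim=> [l|s IHs t IHt] /=; rewrite ?eqxx // IHs IHt. Qed.

Lemma piso_sym : symmetric piso.
Proof.
suff piso_imp s t : piso s t -> piso t s by move=> s t; apply/idP/idP; exact: piso_imp.
elim: s t => [a|s1 IH1 s2 IH2] [b|t1 t2] //=; first by move=> /eqP ->.
by case/orP=> /andP[/IH1 h1 /IH2 h2]; rewrite h1 h2 ?orbT.
Qed.

Lemma piso_trans : transitive piso.
Proof.
move=> t s r; elim: t s r => [b|t1 IH1 t2 IH2] [a|s1 s2] [c|r1 r2] //=.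
  by move=> /eqP -> /eqP ->.
case/orP=> /andP[h1 h2] /orP[]/andP[h3 h4]; apply/orP.
- by left; rewrite (IH1 _ _ h1 h3) (IH2 _ _ h2 h4).
- by right; rewrite (IH1 _ _ h1 h3) (IH2 _ _ h2 h4).
- by right; rewrite (IH2 _ _ h1 h4) (IH1 _ _ h2 h3).
- by left; rewrite (IH2 _ _ h1 h4) (IH1 _ _ h2 h3).
Qed.

Canonical piso_equiv := EquivRel piso piso_refl piso_sym piso_trans.

Definition ltree := {eq_quot piso}%qT.
HB.instance Definition _ := EqQuotient.on ltree.
HB.instance Definition _ := Choice.on ltree.

Definition leaf (l : option 'I_n) : ltree := (\pi_ltree (Leaf l))%qT.

Definition graft (S T : ltree) : ltree :=
  (\pi_ltree (Node (repr S) (repr T)))%qT.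

Definition internal_root (T : ltree) : Prop :=
  exists S R : ltree, T = graft S R.

Fixpoint peval (t : ptree) (u : power Halg n) : Halg :=
  match t with
  | Leaf (Some i) => u i
  | Leaf None => const Halg
  | Node s t => star (peval s u) (peval t u)
  end.

Fixpoint pleaves (t : ptree) : seq (option 'I_n * nat) :=
  match t with
  | Leaf l => [:: (l, 0)]
  | Node s t => [seq (p.1, p.2.+1) | p <- pleaves s ++ pleaves t]
  end.

Definition eval (T : ltree) : power Halg n -> Halg := peval (repr T)%qT.

Definition occurs_at (T : ltree) (i : 'I_n) (k : nat) : bool :=
  (Some i, k) \in pleaves (repr T)%qT.

Definition profile (T : ltree) : power Halg n :=
  [ffun i => \big[hmax/None]_(p <- pleaves (repr T)%qT | p.1 == Some i) Some p.2].

(* Evaluation and occurrences do not depend on the representative. *)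

Lemma hmaxC : commutative hmax.
Proof. by case=> [i|] [j|] //=; rewrite maxnC. Qed.

Lemma peval_iso s t u : piso s t -> peval s u = peval t u.
Proof.
elim: s t => [a|s1 IH1 s2 IH2] [b|t1 t2] //=; first by move=> /eqP ->.
case/orP=> /andP[/IH1 -> /IH2 ->] //.
by rewrite /hstar hmaxC.
Qed.

Lemma pleaves_iso s t : piso s t -> perm_eq (pleaves s) (pleaves t).
Proof.
elim: s t => [a|s1 IH1 s2 IH2] [b|t1 t2] //=; first by move=> /eqP ->.
case/orP=> /andP[/IH1 h1 /IH2 h2]; apply: perm_map; first exact: perm_cat.
by rewrite perm_sym perm_catC perm_sym; exact: perm_cat.
Qed.

Lemma piso_repr s : piso (repr (\pi_ltree s)%qT)%qT s.
Proof. by rewrite -(@eqquotE _ _ ltree); apply/eqP; rewrite reprK. Qed.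

Lemma eval_leaf l u : eval (leaf l) u = if l is Some i then u i else const Halg.
Proof. by rewrite /eval (peval_iso _ (piso_repr _)); case: l. Qed.

Lemma eval_graft S T u : eval (graft S T) u = star (eval S u) (eval T u).
Proof. by rewrite /eval (peval_iso _ (piso_repr _)). Qed.

Lemma occurs_at_leaf l i k : occurs_at (leaf l) i k = (l == Some i) && (k == 0).
Proof.
rewrite /occurs_at (perm_mem (pleaves_iso (piso_repr _))) inE xpair_eqE.
by rewrite eqtype.eq_sym.
Qed.

Lemma occurs_at_graft S T i k :
  occurs_at (graft S T) i k =
  if k is k'.+1 then occurs_at S i k' || occurs_at T i k' else false.
Proof.
rewrite /occurs_at (perm_mem (pleaves_iso (piso_repr _))) /=.
apply/mapP/idP => [[[l m] + /= [-> ->]]|]; first by rewrite mem_cat.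
by case: k => // k h; exists (Some i, k); rewrite // mem_cat.
Qed.

Definition join_eval (Ts : seq ltree) (u : power Halg n) : Halg :=
  \big[hmax/None]_(T <- Ts) eval T u.

Definition join_profile (Ts : seq ltree) : power Halg n :=
  [ffun i => \big[hmax/None]_(T <- Ts) profile T i].

Local Open Scope fset_scope.

Definition languages : bimagma :=
  @Bimagma {fset ltree}
    (fun L M => L `|` M)
    (fun L M => [fset graft S T | S in L, T in M]).

End Trees.

(* The new element [None] is the element adjoined for the empty language. *)
Definition empty_completion (A : bimagma) : bimagma :=
  @Bimagma (option A)
    (fun x y => match x, y with
                | Some a, Some b => Some (join a b)
                | Some a, None => Some a
                | None, _ => y
                end)
    (fun x y => match x, y with
                | Some a, Some b => Some (star a b)
                | _, _ => None
                end).

Definition language_profile (n : nat) (L : languages n) :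
    empty_completion (power Halg n) :=
  if L == fset0 :> {fset ltree n} then None
  else Some (join_profile (L : {fset ltree n})).

Definition absorbing_zero (A : bimagma) (z : A) : Prop :=
  forall x : A,
    [/\ join z x = x, join x z = x, star z x = z & star x z = z].

Definition is_unit (A : bimagma) (e : A) : Prop :=
  forall x : A, star e x = x /\ star x e = x.

Record ualg := UAlg { ubase :> bimagma; uzero : ubase; uone : ubase }.

Definition unital_completion (A : bimagma) (U : ualg) (iota : A -> U) : Prop :=
  [/\ injective iota, bihom iota, absorbing_zero (uzero U) & is_unit (uone U)].

Inductive hat := HatBot | HatUnit | HatIn of height.

Definition hat_join (x y : hat) : hat :=
  match x, y with
  | HatBot, _ => y
  | _, HatBot => x
  | HatUnit, _ => y
  | _, HatUnit => x
  | HatIn a, HatIn b => HatIn (hmax a b)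
  end.

Definition hat_star (x y : hat) : hat :=
  match x, y with
  | HatBot, _ | _, HatBot => HatBot
  | HatUnit, _ => y
  | _, HatUnit => x
  | HatIn a, HatIn b => HatIn (hstar a b)
  end.

Definition Hhat : ualg := @UAlg (Bimagma hat_join hat_star) HatBot HatUnit.

Section TermOperations.

Variable n : nat.

Definition term_op (t : term 'I_n) : power Halg n -> Halg :=
  fun u => eval_term (A := Halg) u t.

Definition is_term_op (f : power Halg n -> Halg) : Prop :=
  exists t : term 'I_n, f = term_op t.

Lemma is_term_op_join f g : is_term_op f -> is_term_op g ->
  is_term_op (fun u => join (f u) (g u)).
Proof. by move=> [s ->] [t ->]; exists (Join s t). Qed.

Lemma is_term_op_star f g : is_term_op f -> is_term_op g ->
  is_term_op (fun u => star (f u) (g u)).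
Proof. by move=> [s ->] [t ->]; exists (Star s t). Qed.

Lemma is_term_op_const : is_term_op (fun=> const Halg).
Proof. by exists Const. Qed.

Lemma is_term_op_proj i : is_term_op (fun u => u i).
Proof. by exists (Var i). Qed.

Definition term_ops : alg :=
  @Alg (@Bimagma {f : power Halg n -> Halg | is_term_op f}
          (fun f g => exist _ _ (is_term_op_join (proj2_sig f) (proj2_sig g)))
          (fun f g => exist _ _ (is_term_op_star (proj2_sig f) (proj2_sig g))))
       (exist _ _ is_term_op_const).

Definition proj_op (i : 'I_n) : term_ops := exist _ _ (is_term_op_proj i).

Definition op_of (f : term_ops) : power Halg n -> Halg := proj1_sig f.

Definition basis_vec (i : 'I_n) : power Halg n :=
  [ffun j => if j == i then Some 0 else None].

End TermOperations.

Fixpoint star_only (V : Type) (t : term V) : bool :=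
  match t with
  | Var _ => true
  | Star s t => star_only s && star_only t
  | _ => false
  end.

Fixpoint vars (V : Type) (t : term V) : seq V :=
  match t with
  | Var x => [:: x]
  | Const => [::]
  | Join s t | Star s t => vars s ++ vars t
  end.

Definition full_linear (n : nat) (t : term 'I_n) : bool :=
  star_only t && perm_eq (vars t) (enum 'I_n).

Local Open Scope ring_scope.

Definition pow2neg (k : nat) : rat := 2%:R ^- k.

Definition kraft_weight (a : height) : rat :=
  if a is Some k then pow2neg k else 0.

Local Open Scope classical_set_scope.

Definition full_linear_ops (n : nat) : set (power Halg n -> Halg) :=
  [set f | exists2 t : term 'I_n, full_linear t & f = term_op t].

Definition dyadic_representations (n : nat) : set {ffun 'I_n -> nat} :=
  [set d | \sum_(i < n) pow2neg (d i) = 1].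

(* Main.v *)
(** Evaluation of a term with [x_i] sent to the basis vector [e_i] yields a
    vector [d], and [lin _ u] is a homomorphism from [H^n] to [H] sending [e_i]
    to [u i]; hence every term operation is [lin d], and [d] is recovered by
    evaluating at the basis vectors.  Freeness then only uses that [H^n] is
    generated by the [e_i] and that terms with equal values at them are
    identified by every algebra of the variety.
    A profile satisfies Kraft's inequality because the leaf weights of a tree
    sum to [1]; conversely, silent leaves pad a Kraft sum to exactly [1], and a
    multiset of depths with Kraft sum [1] is realized by repeatedly grafting two
    trees of maximal depth.  The same realization, without padding, identifies
    full-linear operations with dyadic representations of [1]. *)
Require Import Defs.
From HB Require Import structures.
From mathcomp Require Import all_boot all_order all_algebra.
From mathcomp Require Import finmap.
From mathcomp Require Import generic_quotient.
From mathcomp Require Import boolp classical_sets functions cardinality.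
Set Implicit Arguments.
Unset Strict Implicit.
Unset Printing Implicit Defensive.
Import Order.TTheory GRing.Theory Num.Theory.

(** * Max-plus arithmetic of heights *)

Lemma hmaxA : associative hmax.
Proof. by case=> [i|] [j|] [k|] //=; rewrite maxnA. Qed.

Lemma hmax0 : left_id None hmax.
Proof. by case. Qed.

HB.instance Definition _ :=
  Monoid.isComLaw.Build height None hmax hmaxA hmaxC hmax0.

Lemma hmaxxx : idempotent_op hmax.
Proof. by case=> [i|] //=; rewrite maxnn. Qed.

Lemma hadd0 : right_id (Some 0) hadd.
Proof. by case=> [i|] //=; rewrite addn0. Qed.

Lemma haddN : right_zero None hadd.
Proof. by case. Qed.

Lemma haddA : associative hadd.
Proof. by case=> [i|] [j|] [k|] //=; rewrite addnA. Qed.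

Lemma hadd_maxl : left_distributive hadd hmax.
Proof. by case=> [i|] [j|] [k|] //=; rewrite addn_maxl. Qed.

Lemma hadd_maxr : right_distributive hadd hmax.
Proof. by case=> [i|] [j|] [k|] //=; rewrite addn_maxr. Qed.

(** Both sides are the maximum of the four heights plus one. With idempotence this lets [hstar] pass
    through finite maxima. *)
Lemma hmax_star a b c d :
  hmax (hstar a b) (hstar c d) = hstar (hmax a c) (hmax b d).
Proof. by rewrite /hstar -hadd_maxl Monoid.mulmACA. Qed.

(** A finite value of [hstar] is a maximum plus one. This excludes zero coordinates at an internal
    root and units among the heights. *)
Lemma hstar_neq0 a b : hstar a b <> Some 0.
Proof.
by rewrite /hstar; case: (hmax a b) => [k|] //=; rewrite addn1.
Qed.

(** Turns an iterated [hmax] into the usual description of a maximum; the value [None] belongs to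
    the empty index set and is treated separately. *)
Lemma big_hmaxP (I : eqType) (r : seq I) (P : pred I) (F : I -> nat) k :
  \big[hmax/None]_(i <- r | P i) Some (F i) = Some k <->
  (exists i, [/\ i \in r, P i & F i = k]) /\
  (forall i, i \in r -> P i -> F i <= k).
Proof.
elim: r k => [|x r IHr] k.
  by rewrite big_nil; split=> // -[] [i []].
rewrite big_cons; case: ifP => Px; last first.
  rewrite IHr; split=> -[[i [ir Pi Fi]] h].
    split; first by exists i; rewrite inE ir orbT.
    by move=> j /[!inE] /orP[/eqP ->|]; [rewrite Px | apply: h].
  split=> [|j jr]; last by apply: h; rewrite inE jr orbT.
  by exists i; split=> //; move: ir Pi; rewrite inE => /orP[/eqP ->|]; rewrite ?Px.
case E : (\big[hmax/None]_(i <- r | P i) Some (F i)) => [m|] /=; last first.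
  have no i : i \in r -> P i -> False.
    move=> ir Pi; move: E; rewrite (big_rem i) //= Pi.
    by case: (\big[hmax/None]_(_ <- _ | _) _).
  split=> [[<-]|].
    split; first by exists x; rewrite mem_head.
    by move=> i /[!inE] /orP[/eqP ->|/no ir /ir].
  by move=> [[i [+ Pi Fi]] _]; rewrite inE => /orP[/eqP <-|/no /(_ Pi) //]; rewrite Fi.
have [[i [ir Pi Fi]] h] := (IHr m).1 E.
split=> [[<-]|].
  split; last first.
    move=> j /[!inE] /orP[/eqP ->|jr Pj]; first by rewrite leq_maxl.
    by rewrite (leq_trans (h _ jr Pj)) ?leq_maxr.
  case: (leqP (F x) m) => _.
    by exists i; rewrite inE ir orbT.
  by exists x; rewrite mem_head.
move=> [[j [jr Pj Fj]] hk]; congr Some; apply/eqP; rewrite eqn_leq geq_max.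
rewrite hk ?mem_head //= -{1}Fi hk ?inE ?ir ?orbT //= -Fj.
move: jr; rewrite inE => /orP[/eqP ->|jr]; first by rewrite leq_maxl.
by rewrite (leq_trans (h _ jr Pj)) ?leq_maxr.
Qed.

Lemma big_hmaxNP (I : eqType) (r : seq I) (P : pred I) (F : I -> nat) :
  \big[hmax/None]_(i <- r | P i) Some (F i) = None <->
  (forall i, i \in r -> ~~ P i).
Proof.
split=> [E i ir|h]; last by rewrite big_seq_cond big1 // => i /andP[/h /negP].
apply/negP => Pi; move: E; rewrite (big_rem i) //= Pi.
by case: (\big[hmax/None]_(_ <- _ | _) _).
Qed.

Lemma eval_term_hom (A B : alg) (f : A -> B) (V : Type) (v : V -> A) t :
  alg_hom f -> f (eval_term v t) = eval_term (f \o v) t.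
Proof.
by move=> [[fj fs] fc]; elim: t => [x||s IHs t IHt|s IHs t IHt] //=;
  rewrite ?fj ?fs IHs IHt.
Qed.

Lemma eq_eval_term (A : alg) (V : Type) (v w : V -> A) t :
  v =1 w -> eval_term v t = eval_term w t.
Proof. by move=> vw; elim: t => //= s -> t ->. Qed.

(** * Term operations and their coefficient vectors *)

Section Linear.
Variable n : nat.
Implicit Types (d e u : power Halg n).

(** [hadd] distributes over [hmax], and the shift by one in [hstar] moves through the maximum by
    associativity. *)
Lemma lin_hom u : alg_hom (fun d => lin d u).
Proof.
split; first split.
- move=> d e; rewrite /lin /= -big_split /=.
  by apply: eq_bigr => i _; rewrite ffunE hadd_maxr.
- move=> d e; rewrite /lin /= /hstar -big_split /=.
  rewrite (big_morph (fun x => hadd x (Some 1)) (id1 := None) (op1 := hmax)) //.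
    by apply: eq_bigr => i _; rewrite ffunE -hadd_maxr haddA.
  by move=> x y; rewrite hadd_maxl.
- by rewrite /lin big1 // => i _; rewrite ffunE haddN.
Qed.

Lemma lin_basis i u : lin (basis_vec i) u = u i.
Proof.
rewrite /lin (bigD1 i) //= big1 => [|j ji].
  by rewrite ffunE eqxx hadd0 Monoid.mulm1.
by rewrite ffunE (negbTE ji) haddN.
Qed.

Lemma lin_at_basis d i : lin d (basis_vec i) = d i.
Proof.
rewrite /lin (bigD1 i) //= big1 => [|j ji].
  by rewrite ffunE eqxx Monoid.mulm1; case: (d i).
by rewrite ffunE (negbTE ji).
Qed.

Lemma lin_inj d e : (forall u, lin d u = lin e u) -> d = e.
Proof. by move=> h; apply/ffunP => i; rewrite -!lin_at_basis. Qed.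

Definition coef (t : term 'I_n) : power Halg n := eval_term (@basis_vec n) t.

Lemma term_op_lin t u : term_op t u = lin (coef t) u.
Proof.
rewrite (eval_term_hom _ _ (lin_hom u)).
by apply: eq_eval_term => i /=; rewrite lin_basis.
Qed.

Lemma term_op_coef s t : (term_op s = term_op t) <-> (coef s = coef t).
Proof.
split=> [h|h]; last by apply/funext => u; rewrite !term_op_lin h.
by apply: lin_inj => u; rewrite -!term_op_lin h.
Qed.

(** Since [hstar a a] is [a] plus one, [k] successive squarings of [x_i] give [u_i + k]. *)
Definition monomial (i : 'I_n) (a : height) : term 'I_n :=
  if a is Some k then iter k (fun t => Star t t) (Var i) else Const.

Definition linear_term d : term 'I_n :=
  foldr (fun i => Join (monomial i (d i))) Const (enum 'I_n).

Lemma coef_monomial i a :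
  coef (monomial i a) = [ffun j => if j == i then a else None].
Proof.
case: a => [k|] /=; last by apply/ffunP => j; rewrite !ffunE if_same.
elim: k => [|k IHk] //=; rewrite /coef /= -/(coef _) IHk.
apply/ffunP => j; rewrite !ffunE /= /hstar hmaxxx.
by case: ifP => //= _; rewrite addn1.
Qed.

Lemma coef_linear_term d : coef (linear_term d) = d.
Proof.
apply/ffunP => j.
have -> : coef (linear_term d) j =
    \big[hmax/None]_(i <- enum 'I_n) coef (monomial i (d i)) j.
  rewrite /linear_term; elim: (enum 'I_n) => [|i r IHr] /=.
    by rewrite big_nil ffunE.
  by rewrite big_cons -IHr ffunE.
rewrite big_enum (bigD1 j) //= big1 => [|i ij].
  by rewrite coef_monomial ffunE eqxx Monoid.mulm1.
by rewrite coef_monomial ffunE eq_sym (negbTE ij).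
Qed.

Lemma is_term_op_lin d : is_term_op (lin d).
Proof.
by exists (linear_term d); apply/funext => u; rewrite term_op_lin coef_linear_term.
Qed.

(** Read off from values at the basis vectors, so that no choice of a term for [f] enters. *)
Definition op_coef (f : term_ops n) : power Halg n :=
  [ffun i => op_of f (basis_vec i)].

Lemma op_coefE (f : term_ops n) d :
  (forall u, op_of f u = lin d u) <-> op_coef f = d.
Proof.
split=> [h|<- u]; first by apply/ffunP => i; rewrite ffunE h lin_at_basis.
case: f => f [t ft]; subst f; rewrite /op_of /= term_op_lin; congr lin.
by apply/ffunP => i; rewrite ffunE /op_of /= term_op_lin lin_at_basis.
Qed.

Lemma op_of_inj : injective (@op_of n).
Proof.
by move=> [f pf] [g pg] /= fg; subst g; congr exist; apply: Prop_irrelevance.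
Qed.

Lemma op_coef_hom : alg_hom op_coef.
Proof. by split; [split=> f g|]; apply/ffunP => i; rewrite !ffunE. Qed.

Lemma op_coef_bij : bijective op_coef.
Proof.
exists (fun d => exist _ _ (is_term_op_lin d)) => [f|d].
  by apply: op_of_inj; apply/funext => u; rewrite ((op_coefE f _).2 erefl).
by apply/op_coefE.
Qed.

End Linear.

(** * Free algebras in the variety of heights *)

Section Free.

(** Choosing a term for each element of [F] defines the extension. The third hypothesis makes its
    values independent of the choice, hence a homomorphism; uniqueness holds because [g] generates
    [F]. *)
Lemma free_in_variety (A F : alg) (I : Type) (g : I -> F) :
  variety A F ->
  (forall x, exists t, x = eval_term g t) ->
  (forall (B : alg) (b : I -> B), variety A B ->
     forall s t, eval_term g s = eval_term g t -> eval_term b s = eval_term b t) ->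
  free_in (variety A) g.
Proof.
move=> AF gen ind; split=> // B AB b.
have /choice[w wE] := gen.
have evE t : eval_term b (w (eval_term g t)) = eval_term b t.
  by apply: ind.
exists (fun x => eval_term b (w x)); split=> [|psi [psih psig]].
  split; last by move=> i; have := evE (Var i).
  split; last exact: (evE Const).
  split=> x y.
    by have := evE (Join (w x) (w y)); rewrite /= -!wE.
  by have := evE (Star (w x) (w y)); rewrite /= -!wE.
apply/funext => x; rewrite {2}(wE x) eval_term_hom //.
by apply: eq_eval_term => i; rewrite /= psig.
Qed.

Fixpoint term_map (V W : Type) (f : V -> W) (t : term V) : term W :=
  match t with
  | Var x => Var (f x)
  | Const => Const
  | Join s t => Join (term_map f s) (term_map f t)
  | Star s t => Star (term_map f s) (term_map f t)
  end.

Lemma eval_term_map (A : alg) (V W : Type) (f : V -> W) (v : W -> A) t :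
  eval_term v (term_map f t) = eval_term (v \o f) t.
Proof. by elim: t => //= s -> t ->. Qed.

Variable n : nat.

(** Identities in [variety] have variables in [nat], so terms over ['I_n] are renamed along [val]
    first. *)
Lemma variety_term_op (B : alg) (b : 'I_n -> B) s t :
  variety Halg B -> term_op s = term_op t -> eval_term b s = eval_term b t.
Proof.
move=> VB st.
(* Indices from [n] on get the default [const B]; the renamed terms contain only smaller ones. *)
pose v k := if insub k is Some i then b i else const B.
have vE : v \o val =1 b by move=> i; rewrite /= /v valK.
rewrite -!(eq_eval_term _ vE) -!eval_term_map; apply: VB => w.
rewrite !eval_term_map.
have E r : eval_term (A := Halg) (w \o val) r = term_op r [ffun i => w (val i)].
  by apply: eq_eval_term => i; rewrite ffunE.
by rewrite !E st.
Qed.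

Lemma variety_power : variety Halg (power Halg n).
Proof.
move=> s t st v; apply/ffunP => i.
have h : @alg_hom (power Halg n) Halg (fun d => d i).
  by split; [split=> d e|]; rewrite /= ffunE.
by rewrite !(eval_term_hom _ _ h).
Qed.

Lemma op_of_hom (u : power Halg n) :
  @alg_hom (term_ops n) Halg (fun f => op_of f u).
Proof. by []. Qed.

Lemma variety_term_ops : variety Halg (term_ops n).
Proof.
move=> s t st v; apply: op_of_inj; apply/funext => u.
by rewrite !(eval_term_hom _ _ (op_of_hom u)).
Qed.

Lemma op_of_eval_proj t : op_of (eval_term (@proj_op n) t) = term_op t.
Proof. by apply/funext => u; rewrite (eval_term_hom _ _ (op_of_hom u)). Qed.

Lemma free_term_ops : free_in (variety Halg) (@proj_op n).
Proof.
apply: free_in_variety => [|[f [t ft]]|B b VB s t st].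
- exact: variety_term_ops.
- by subst f; exists t; apply: op_of_inj; rewrite op_of_eval_proj.
- by apply: variety_term_op => //; rewrite -!op_of_eval_proj st.
Qed.

Lemma free_power : free_in (variety Halg) (@basis_vec n).
Proof.
apply: free_in_variety => [|d|B b VB s t st].
- exact: variety_power.
- by exists (linear_term d); rewrite -/(coef _) coef_linear_term.
- by apply: variety_term_op => //; apply/term_op_coef.
Qed.

End Free.

(** * Depth profiles of trees and of finite joins *)

Section Profiles.
Variable n : nat.
Implicit Types (s t : ptree n) (S T : ltree n).

Definition pprofile t : power Halg n :=
  [ffun i => \big[hmax/None]_(p <- pleaves t | p.1 == Some i) Some p.2].

(** Plane trees are the [Join]-free terms, so facts on [coef] and [term_op] carry over to profiles
    and evaluation. *)
Fixpoint pterm t : term 'I_n :=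
  match t with
  | Leaf (Some i) => Var i
  | Leaf None => Const
  | Node s t => Star (pterm s) (pterm t)
  end.

Lemma pevalE t u : peval t u = term_op (pterm t) u.
Proof. by elim: t => [[i|]|s IHs t IHt] //=; rewrite IHs IHt. Qed.

Lemma pprofileE t : pprofile t = coef (pterm t).
Proof.
elim: t => [[i|]|s IHs t IHt].
- apply/ffunP => j; rewrite !ffunE /= big_cons big_nil /=.
  by rewrite (inj_eq Some_inj) eq_sym.
- by apply/ffunP => j; rewrite !ffunE /= big_cons big_nil.
- rewrite /coef /= -!/(coef _) -IHs -IHt.
  (* Grafting raises every leaf depth by one, which matches the shift in [hstar]. *)
  apply/ffunP => i; rewrite !ffunE /= big_map big_cat /hstar /=.
  rewrite hadd_maxl; congr hmax; symmetry;
    rewrite (big_morph (fun x => hadd x (Some 1)) (id1 := None) (op1 := hmax)) //;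
    try by move=> x y; rewrite hadd_maxl.
  all: by apply: eq_bigr => p _ /=; rewrite addn1.
Qed.

Lemma peval_lin t u : peval t u = lin (pprofile t) u.
Proof. by rewrite pevalE pprofileE term_op_lin. Qed.

Lemma pprofile_iso s t : piso s t -> pprofile s = pprofile t.
Proof.
by move=> st; apply/ffunP => i; rewrite !ffunE (perm_big _ (pleaves_iso st)).
Qed.

Lemma profile_pi t : profile (\pi_(ltree n) t)%qT = pprofile t.
Proof. exact: (pprofile_iso (piso_repr t)). Qed.

Lemma eval_lin T u : eval T u = lin (profile T) u.
Proof. exact: peval_lin. Qed.

Lemma eval_profile S T : (forall u, eval S u = eval T u) <-> profile S = profile T.
Proof.
split=> [h|h u]; last by rewrite !eval_lin h.
by apply: lin_inj => u; rewrite -!eval_lin h.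
Qed.

Lemma pprofileP t i k :
  pprofile t i = Some k <->
  (Some i, k) \in pleaves t /\ (forall m, (Some i, m) \in pleaves t -> m <= k).
Proof.
rewrite ffunE big_hmaxP; split=> [[[[l m] /= [lt /eqP li mk]] h]|[tk h]].
  by subst l m; split=> // m' tm'; apply: (h (Some i, m')).
split=> [|[l m] /= lt /eqP li]; first by exists (Some i, k).
by apply: h; rewrite -li.
Qed.

Lemma profileNP T i : profile T i = None <-> (forall m, ~~ occurs_at T i m).
Proof.
rewrite ffunE big_hmaxNP; split=> [h m|h [l m] /= lT].
  by apply/negP => /h /=; rewrite eqxx.
by apply/eqP => li; have := h m; rewrite /occurs_at -li lT.
Qed.

Lemma profile_leaf l :
  profile (leaf l) = if l is Some i then basis_vec i else const (power Halg n).
Proof. by rewrite profile_pi pprofileE; case: l. Qed.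

Lemma profile_graft S T : profile (graft S T) = star (profile S) (profile T).
Proof.
by rewrite profile_pi pprofileE /coef /= -!/(coef _) -!pprofileE.
Qed.

(** For finite [a], the complete binary tree of that depth with every leaf labelled [x_i]. *)
Definition tree_monomial (i : 'I_n) (a : height) : ltree n :=
  if a is Some k then iter k (fun T => graft T T) (leaf (Some i)) else leaf None.

Lemma profile_tree_monomial i a :
  profile (tree_monomial i a) = [ffun j => if j == i then a else None].
Proof.
rewrite -coef_monomial; case: a => [k|] /=; last by rewrite profile_leaf.
by elim: k => [|k IHk] /=; rewrite ?profile_leaf // profile_graft IHk.
Qed.

Lemma join_eval_lin Ts u : join_eval Ts u = lin (join_profile Ts : power Halg n) u.
Proof.
have [[lj _] lc] := lin_hom u.
elim: Ts => [|T Ts IHTs].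
  rewrite /join_eval big_nil -[LHS]lc; congr lin.
  by apply/ffunP => i; rewrite !ffunE big_nil.
rewrite /join_eval big_cons -/(join_eval _ _) IHTs eval_lin.
have := lj (profile T) (join_profile Ts); rewrite /= => <-; congr lin.
by apply/ffunP => i; rewrite !ffunE big_cons ffunE.
Qed.

Lemma join_profile_surj d : exists Ts : seq (ltree n),
  [/\ Ts <> [::], join_profile Ts = d & forall u, join_eval Ts u = lin d u].
Proof.
(* The silent leaf keeps the list nonempty and contributes only [None] to the maximum. *)
pose Ts := leaf None :: [seq tree_monomial i (d i) | i <- enum 'I_n].
have TsE : join_profile Ts = d.
  apply/ffunP => j; rewrite ffunE /Ts big_cons profile_leaf ffunE hmax0.
  rewrite big_map big_enum (bigD1 j) //= big1 => [|i ij].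
    by rewrite profile_tree_monomial ffunE eqxx Monoid.mulm1.
  by rewrite profile_tree_monomial ffunE eq_sym (negbTE ij).
by exists Ts; split=> // u; rewrite join_eval_lin TsE.
Qed.

End Profiles.

(** * Kraft's inequality and its converse *)

Section Kraft.
Local Open Scope ring_scope.
Variable n : nat.
Implicit Types (s t : ptree n) (d : power Halg n).

Definition shift k (r : seq (option 'I_n * nat)) :=
  [seq (p.1, (k + p.2)%N) | p <- r].

(** A pair [(t, k)] stands for a tree whose root is to sit at depth [k] of a larger tree; leaves are
    listed at their final depths. *)
Definition forest_leaves (F : seq (ptree n * nat)) :=
  flatten [seq shift p.2 (pleaves p.1) | p <- F].

Lemma perm_forest_leaves F G : perm_eq F G ->
  perm_eq (forest_leaves F) (forest_leaves G).
Proof. by move=> FG; apply: perm_flatten; apply: perm_map. Qed.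

Lemma forest_leaves_merge s t k F :
  forest_leaves ((Node s t, k) :: F) = forest_leaves ((s, k.+1) :: (t, k.+1) :: F).
Proof.
rewrite /forest_leaves /= catA; congr (_ ++ _).
rewrite /shift -map_comp map_cat; congr (_ ++ _);
  by apply: eq_map => p /=; rewrite addnS.
Qed.

(* Parity forces the trees at the maximal depth [K.+1] to come in pairs, and two
   of them can be grafted. *)
Lemma forest_merge K (F : seq (ptree n * nat)) :
  all (fun p => p.2 <= K)%N F -> (\sum_(p <- F) 2 ^ (K - p.2) = 2 ^ K)%N ->
  exists t, perm_eq (pleaves t) (forest_leaves F).
Proof.
elim: K F => [|K IHK] F.
  move=> /allP F0; rewrite (eq_bigr (fun=> 1%N)) // sum1_size => sF.
  case: F sF F0 => [|[t k] [|]] // _ /(_ (t, k) (mem_head _ _)) /=.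
  rewrite leqn0 => /eqP ->; exists t.
  by rewrite /forest_leaves /= cats0 /shift (eq_map (g := id)) ?map_id //; case.
(* Inner induction on the number of trees, which drops by one with each grafting. *)
have [m] := ubnP (size F); elim: m F => // m IHm F /ltnSE sF FK sumF.
have [hF|noF] := boolP (has (fun p => p.2 == K.+1) F); last first.
  have F'K : all (fun p => p.2 <= K)%N F.
    apply/allP => p pF; have := allP FK p pF; rewrite leq_eqVlt => /orP[pK|//].
    by case/negP: noF; apply/hasP; exists p.
  (* With no tree at depth [K.+1] every summand is even, and the equation halves to the bound
     [K]. *)
  apply: IHK => //; apply/eqP; rewrite -(eqn_pmul2l (m := 2)) // -expnS -sumF.
  rewrite big_distrr /=; apply/eqP; apply: eq_big_seq => p pF.
  by rewrite -expnS subSn //; exact: (allP F'K).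
have [[s k] sin /= /eqP kK] := hasP hF; subst k.
have pF := perm_to_rem sin; set F' := rem _ _ in pF.
have F'K : all (fun p => p.2 <= K.+1)%N F'.
  by move: FK; rewrite (perm_all _ pF) /= => /andP[].
move: sumF; rewrite (perm_big _ pF) big_cons /= subnn => sumF'.
have [hF'|noF'] := boolP (has (fun p => p.2 == K.+1) F'); last first.
  move/(congr1 odd): sumF'; rewrite oddD [in RHS]oddX /= => /negbFE.
  rewrite big_seq (big_morph odd oddD (erefl _)) big1 //= => p pF'.
  have := allP F'K p pF'; rewrite leq_eqVlt => /orP[pK|pK].
    by case/negP: noF'; apply/hasP; exists p.
  by rewrite subSn // oddX.
have [[t k] tin /= /eqP kK] := hasP hF'; subst k.
have pF' := perm_to_rem tin; set F'' := rem _ _ in pF'.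
have F''K : all (fun p => p.2 <= K.+1)%N F''.
  by move: F'K; rewrite (perm_all _ pF') /= => /andP[].
move: sumF'; rewrite (perm_big _ pF') big_cons /= subnn => sumF''.
have perm2 : perm_eq F ((s, K.+1) :: (t, K.+1) :: F'').
  by rewrite (permPl pF) perm_cons.
(* Two weights 1 at depth [K.+1] become one weight 2 at depth [K], so the sum is kept. *)
have [||| r rE] := IHm ((Node s t, K) :: F'').
- by move: sF; rewrite (perm_size perm2) /=.
- by rewrite /= leqnSn.
- by rewrite big_cons /= subSnn -sumF'' addnA.
exists r; rewrite (permPl rE) forest_leaves_merge.
by apply: perm_forest_leaves; rewrite perm_sym.
Qed.

Lemma pow2neg_subn K k : (k <= K)%N -> pow2neg k = (2 ^ (K - k))%N%:R * pow2neg K.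
Proof.
move=> kK; rewrite /pow2neg natrX -{2}(subnK kK) exprD invfM mulrA mulfV ?mul1r //.
by rewrite expf_neq0 // pnatr_eq0.
Qed.

(** The common denominator [2 ^ K] reduces Kraft sums to natural numbers, where parity applies. *)
Lemma sum_pow2neg (r : seq (option 'I_n * nat)) K :
  all (fun p => p.2 <= K)%N r ->
  \sum_(p <- r) pow2neg p.2 = (\sum_(p <- r) 2 ^ (K - p.2))%N%:R * pow2neg K.
Proof.
move=> /allP rK; rewrite natr_sum mulr_suml; apply: eq_big_seq => p /rK.
exact: pow2neg_subn.
Qed.

Lemma pow2neg_gt0 k : 0 < pow2neg k.
Proof. by rewrite invr_gt0 exprn_gt0. Qed.

Lemma natr_pow2neg m k : (m%:R * pow2neg k <= 1) = (m <= 2 ^ k)%N.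
Proof.
by rewrite ler_pdivrMr ?mul1r ?exprn_gt0 // -natrX ler_nat.
Qed.

Lemma natr_pow2neg_eq1 m k : (m%:R * pow2neg k == 1) = (m == 2 ^ k)%N.
Proof.
rewrite -(inj_eq (mulIf (x := 2 ^+ k : rat) _)) ?expf_neq0 ?pnatr_eq0 //.
by rewrite mul1r mulfVK ?expf_neq0 ?pnatr_eq0 // -natrX eqr_nat.
Qed.

Lemma exists_depth_bound (r : seq (option 'I_n * nat)) :
  exists K, all (fun p => p.2 <= K)%N r.
Proof.
exists (\max_(p <- r) p.2)%N; apply/allP => p pr.
exact: (leq_bigmax_seq (F := fun p => p.2)).
Qed.

Lemma kraft_realize (r : seq (option 'I_n * nat)) :
  \sum_(p <- r) pow2neg p.2 = 1 -> exists t, perm_eq (pleaves t) r.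
Proof.
have [K rK] := exists_depth_bound r.
rewrite (sum_pow2neg rK) => /eqP; rewrite natr_pow2neg_eq1 => /eqP sumr.
have [||t tE] := @forest_merge K [seq (Leaf p.1, p.2) | p <- r].
- by rewrite all_map.
- by rewrite big_map.
exists t; rewrite (permPl tE) /forest_leaves -map_comp /=.
rewrite (eq_map (g := fun p => [:: p])) ?flatten_seq1 ?perm_refl //.
by case=> l k; rewrite /= addn0.
Qed.

Lemma kraft_pad (r : seq (option 'I_n * nat)) :
  \sum_(p <- r) pow2neg p.2 <= 1 ->
  exists m K, \sum_(p <- nseq m (None, K) ++ r) pow2neg p.2 = 1.
Proof.
have [K rK] := exists_depth_bound r.
rewrite (sum_pow2neg rK) natr_pow2neg => sumr.
(* The deficit is a multiple of [2 ^- K], filled by that many silent leaves at depth [K]. *)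
exists (2 ^ K - \sum_(p <- r) 2 ^ (K - p.2))%N, K.
apply/eqP; rewrite big_cat /= (sum_pow2neg rK) big_nseq iter_addr_0 /=.
by rewrite -[pow2neg K *+ _]mulr_natl -mulrDl -natrD subnK // natr_pow2neg_eq1.
Qed.

(** Grafting halves the total weight of each subtree, and the two halves add up to 1. *)
Lemma kraft_pleaves t : \sum_(p <- pleaves t) pow2neg p.2 = 1.
Proof.
elim: t => [l|s IHs t IHt] /=; first by rewrite big_seq1.
rewrite big_map big_cat /=.
have half u : \sum_(p <- pleaves u) pow2neg p.2 = 1 ->
    \sum_(p <- pleaves u) pow2neg p.2.+1 = 2^-1 :> rat.
  move=> u1; rewrite -[RHS]mulr1 -[X in _ * X]u1 mulr_sumr.
  by apply: eq_bigr => p _; rewrite /pow2neg exprS invfM.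
by rewrite !half // -mulr2n -mulr_natl mulfV.
Qed.

Lemma kraft_pprofile t : \sum_(i < n) kraft_weight (pprofile t i) <= 1.
Proof.
rewrite -(kraft_pleaves t).
(* The greatest depth of [x_i] is attained at a leaf, whose weight is one of the summands on the
   right. *)
have ge i : kraft_weight (pprofile t i) <=
    \sum_(p <- pleaves t | p.1 == Some i) pow2neg p.2.
  case E : (pprofile t i) => [k|] /=; last first.
    by apply: sumr_ge0 => p _; apply/ltW/pow2neg_gt0.
  have [tk _] := (pprofileP _ _ _).1 E.
  rewrite (big_rem _ tk) /= eqxx lerDl.
  by apply: sumr_ge0 => p _; apply/ltW/pow2neg_gt0.
apply: (le_trans (ler_sum _ (fun i _ => ge i))).
(* After the exchange each leaf counts once for its variable, or not at all if it is silent. *)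
rewrite (exchange_big_dep predT) //= ler_sum // => -[[i|] k] _ /=.
  by rewrite (big_pred1 i) // => j; rewrite (inj_eq Some_inj) eq_sym.
by rewrite big_pred0 // ltW // pow2neg_gt0.
Qed.

Lemma kraft_pprofile_surj d :
  \sum_(i < n) kraft_weight (d i) <= 1 -> exists t, pprofile t = d.
Proof.
(* One leaf for each variable with a finite coordinate; the padding is silent and leaves the profile
   unchanged. *)
pose r := pmap (fun i => omap (pair (Some i)) (d i)) (enum 'I_n).
have -> : \sum_(i < n) kraft_weight (d i) = \sum_(p <- r) pow2neg p.2.
  rewrite /r -big_enum /=; elim: (enum 'I_n) => [|i e IHe].
    by rewrite !big_nil.
  by rewrite big_cons IHe /=; case: (d i) => [k|] /=; rewrite ?big_cons ?add0r.
move=> /kraft_pad[m [K /kraft_realize[t tE]]]; exists t.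
apply/ffunP => i.
have mem j k : ((Some j, k) \in pleaves t) = (d j == Some k).
  rewrite (perm_mem tE) mem_cat mem_nseq /= andbF /= mem_pmap.
  apply/mapP/eqP => [[j' _]|djk].
    by case E : (d j') => [k'|] //= [-> ->].
  by exists j; rewrite ?mem_enum ?djk.
case E : (d i) => [k|].
  apply/pprofileP; rewrite mem E eqxx; split=> // m'.
  by rewrite mem E => /eqP[->].
rewrite ffunE; apply/big_hmaxNP => -[l k] /= tl; apply/eqP => li.
by move: tl; rewrite li mem E.
Qed.

Lemma profile_kraft d :
  (exists T : ltree n, profile T = d) <-> \sum_(i < n) kraft_weight (d i) <= 1.
Proof.
split=> [[T <-]|/kraft_pprofile_surj[t <-]]; first exact: kraft_pprofile.
by exists (\pi_(ltree n) t)%qT; rewrite profile_pi.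
Qed.

Lemma leaf_or_graft (T : ltree n) : (exists l, T = leaf l) \/ internal_root T.
Proof.
rewrite -[T]reprK; case: (repr T) => [l|s t]; [by left; exists l | right].
exists (\pi_(ltree n) s)%qT, (\pi_(ltree n) t)%qT; apply/eqP.
(* [graft] passes through chosen representatives, so the plane trees agree only up to [piso]. *)
by rewrite /graft eqquotE /= (piso_sym s) (piso_sym t) !piso_repr.
Qed.

Lemma profile_internal_root d : \sum_(i < n) kraft_weight (d i) <= 1 ->
  (exists T : ltree n, internal_root T /\ profile T = d) <->
  (forall i, d i <> Some 0%N).
Proof.
move=> /profile_kraft[T TE]; split=> [[_ [[S [R ->]] <-]] i|dN0].
  by rewrite profile_graft ffunE; apply: hstar_neq0.
(* A one-leaf tree must be silent here, since a variable would give a coordinate 0; the grafting of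
   two silent leaves has the same profile. *)
have [[l Tl]|] := leaf_or_graft T; last by exists T.
exists (graft (leaf None) (leaf None)); split; first by do 2!eexists.
rewrite -TE Tl profile_graft !profile_leaf; apply/ffunP => i; rewrite !ffunE.
case: l Tl => [j|] Tl; last by rewrite ffunE.
by case: (dN0 j); rewrite -TE Tl profile_leaf ffunE eqxx.
Qed.

End Kraft.

(** * Profiles of finite tree languages *)

Section Languages.
Variable n : nat.

(** Iterates [hmax_star], with [hmaxxx] merging repeated arguments. Nonemptiness matters: an empty
    maximum is [None], whereas [hstar (Some k) None] is [Some k.+1]. *)
Lemma hstar_big (I J : Type) (r : seq I) (q : seq J)
    (f : I -> height) (g : J -> height) :
  ~~ nilp r -> ~~ nilp q ->
  \big[hmax/None]_(i <- r) \big[hmax/None]_(j <- q) hstar (f i) (g j) =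
  hstar (\big[hmax/None]_(i <- r) f i) (\big[hmax/None]_(j <- q) g j).
Proof.
move=> r0 q0.
have inner a : \big[hmax/None]_(j <- q) hstar a (g j) =
    hstar a (\big[hmax/None]_(j <- q) g j).
  case: q q0 => // y q _; elim: q y => [|z q IHq] y; first by rewrite !big_seq1.
  by rewrite big_cons IHq hmax_star hmaxxx [in RHS]big_cons.
under eq_bigr do rewrite inner.
case: r r0 => // x r _; elim: r x => [|z r IHr] x; first by rewrite !big_seq1.
by rewrite big_cons IHr hmax_star hmaxxx [in RHS]big_cons.
Qed.

(** Idempotence of [hmax] makes repetitions harmless, so a finite set of trees may be replaced by a
    concatenation or a list of all pairwise graftings. *)
Lemma eq_mem_join_profile (Ts Us : seq (ltree n)) :
  Ts =i Us -> join_profile Ts = join_profile Us.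
Proof.
by move=> TU; apply/ffunP => i; rewrite !ffunE; apply: eq_big_idem => //; exact: hmaxxx.
Qed.

Lemma nilp_fset (K : choiceType) (A : {fset K}) :
  nilp (A : seq K) = (A == fset0)%fset.
Proof. by rewrite /nilp cardfs_eq0. Qed.

Lemma language_profile_bihom : bihom (@language_profile n).
Proof.
split=> L M; rewrite /language_profile /=.
- have -> : ((L `|` M)%fset == fset0) = (L == fset0) && (M == fset0).
    by rewrite fsetU_eq0.
  case: (eqVneq L fset0) => [->|L0] /=; case: (eqVneq M fset0) => [M0|M0] //=.
  + by rewrite fset0U.
  + by rewrite M0 fsetU0.
  + congr Some; rewrite (@eq_mem_join_profile _ (L ++ M)) => [|T].
      by apply/ffunP => i; rewrite !ffunE big_cat.
    by rewrite mem_cat in_fsetU.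
- set LM := [fset _ | _ in _, _ in _]%fset.
  have LME : LM =i [seq graft Q T | Q <- L, T <- M].
    move=> T; apply/imfset2P/allpairsP => [[S SL [R RM ->]]|[[S R] /= [SL RM ->]]].
      by exists (S, R).
    by exists S => //; exists R.
  (* Emptiness of the product, which decides the absorbing case, is read off from the size of the
     list of pairs. *)
  have LM0 : (LM == fset0) = (L == fset0) || (M == fset0).
    have := eq_has_r LME predT; rewrite !has_predT size_allpairs muln_gt0 !lt0n.
    by move/(congr1 negb); rewrite negb_and !negbK -!nilp_fset.
  rewrite LM0; case: (eqVneq L fset0) => [//|L0] /=.
  case: (eqVneq M fset0) => [//|M0] /=; congr Some.
  rewrite (eq_mem_join_profile LME); apply/ffunP => i; rewrite !ffunE.
  rewrite big_allpairs_dep /= -hstar_big ?nilp_fset //.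
  by apply: eq_bigr => S _; apply: eq_bigr => T _; rewrite profile_graft ffunE.
Qed.

Lemma languages_absorbing : absorbing_zero (fset0 : languages n).
Proof.
move=> L; split; rewrite /= ?fset0U ?fsetU0 //; apply/fsetP => T; rewrite in_fset0.
  by apply/negP => /imfset2P[S]; rewrite in_fset0.
by apply/negP => /imfset2P[S _ [R]]; rewrite in_fset0.
Qed.

Lemma language_profile_None (L : languages n) :
  language_profile L = None <-> L = fset0.
Proof. by rewrite /language_profile; case: eqP. Qed.

End Languages.

(** * Absorbing zeros and units in completions *)

Lemma empty_completion_absorbing (A : bimagma) :
  absorbing_zero (None : empty_completion A).
Proof. by case. Qed.

Lemma Hhat_unital : @unital_completion Halg Hhat HatIn.
Proof.
split; [by move=> a b [] | by [] | by case | by case].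
Qed.

(** If unit and zero agreed, multiplying any element by them would make it zero; [U] would collapse
    to a point, against injectivity of [iota]. *)
Lemma unital_completion_distinct (A : bimagma) (U : ualg) (iota : A -> U)
    (x y : A) :
  star x y <> y -> unital_completion iota -> uone U <> uzero U.
Proof.
move=> xy [inj _ zero one] E; apply: xy; apply: inj.
have all0 z : z = uzero U by rewrite -(one z).1 E; case: (zero z).
by rewrite [LHS]all0 [RHS]all0.
Qed.

(** If [iota a] were the unit, injectivity would make [a] a left identity of [A]. *)
Lemma unital_completion_new (A : bimagma) (U : ualg) (iota : A -> U) :
  (forall a : A, exists b, star a b <> b) -> unital_completion iota ->
  forall a : A, iota a <> uone U.
Proof.
move=> noid [inj [_ istar] _ one] a E; have [b] := noid a; apply.
by apply: inj; rewrite istar E (one _).1.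
Qed.

Lemma power_star0_neq n (a : power Halg n) : 0 < n ->
  star a ([ffun=> Some 0] : power Halg n) <> [ffun=> Some 0].
Proof.
by move=> n0 /ffunP/(_ (Ordinal n0)); rewrite !ffunE; apply: hstar_neq0.
Qed.

(** * Full-linear terms and dyadic representations of 1 *)

Section FullLinear.
Variable n : nat.
Implicit Types (s t : ptree n).

Lemma shift_Node k s t :
  shift k (pleaves (Node s t)) = shift k.+1 (pleaves s) ++ shift k.+1 (pleaves t).
Proof.
by rewrite /shift -map_comp -map_cat; apply: eq_map => p /=; rewrite addnS.
Qed.

Lemma shift_pleaves_cons k s : exists l m r,
  shift k (pleaves s) = (l, k + m) :: r.
Proof.
elim: s k => [l|s IHs t IHt] k; first by exists l, 0, [::].
have [l [m [r E]]] := IHs k.+1.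
by exists l, m.+1, (r ++ shift k.+1 (pleaves t)); rewrite shift_Node E addnS.
Qed.

(* The depth of the first leaf tells whether the root is a leaf, so that the leaf
   sequences of trees form a prefix code. *)
Lemma shift_pleaves_prefix k s t a b :
  shift k (pleaves s) ++ a = shift k (pleaves t) ++ b -> s = t /\ a = b.
Proof.
elim: s t k a b => [l|s1 IH1 s2 IH2] [l'|t1 t2] k a b.
- by rewrite /= => -[-> ->].
(* A leaf at depth [k] cannot match a first leaf at depth [k.+1 + m]. *)
- rewrite shift_Node; have [l' [m [r ->]]] := shift_pleaves_cons k.+1 t1.
  by rewrite /= => -[_]; rewrite addn0 => /eqP;
    rewrite addSn -addnS -{1}[k]addn0 eqn_add2l.
- rewrite shift_Node; have [l [m [r ->]]] := shift_pleaves_cons k.+1 s1.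
  by rewrite /= => -[_]; rewrite addn0 => /eqP;
    rewrite addSn -addnS -{2}[k]addn0 eqn_add2l.
- by rewrite !shift_Node -!catA => /IH1[-> /IH2[-> ->]].
Qed.

Lemma pleaves_inj : injective (@pleaves n).
Proof.
move=> s t st; have [] // := @shift_pleaves_prefix 0 s t [::] [::].
by rewrite st.
Qed.

Lemma pterm_vars t : vars (pterm t) = pmap fst (pleaves t).
Proof.
elim: t => [[i|]|s IHs t IHt] //=.
by rewrite IHs IHt -pmap_cat; elim: (_ ++ _) => //= p r ->.
Qed.

Lemma star_only_pterm t : star_only (pterm t) = all (isSome \o fst) (pleaves t).
Proof.
elim: t => [[i|]|s IHs t IHt] //=.
by rewrite IHs IHt all_map -all_cat; apply: eq_all.
Qed.

Lemma star_onlyP (t : term 'I_n) : star_only t ->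
  exists2 p, pterm p = t & [seq l.1 | l <- pleaves p] = map Some (vars t).
Proof.
elim: t => [i||s IHs t IHt|s IHs t IHt] //=; first by exists (Leaf (Some i)).
case/andP=> /IHs[p <- pE] /IHt[q <- qE]; exists (Node p q) => //=.
by rewrite -map_comp map_cat map_cat -pE -qE.
Qed.

Lemma uniq_fst_inj (I J : eqType) (r : seq (I * J)) i j j' :
  uniq [seq p.1 | p <- r] -> (i, j) \in r -> (i, j') \in r -> j = j'.
Proof.
elim: r => [|[x y] r IHr] //= /andP[xr /IHr IH]; rewrite !inE !xpair_eqE.
have nr z : (x, z) \in r -> False.
  by move=> /(map_f fst) /= h; rewrite h in xr.
case/orP=> [/andP[/eqP -> /eqP ->]|ij] /orP[/andP[/eqP xi /eqP ->]|ij'] //.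
- by case: (nr _ ij').
- by case: (nr j); rewrite -xi.
- exact: IH.
Qed.

Lemma pprofile_uniq t i k : uniq [seq p.1 | p <- pleaves t] ->
  (Some i, k) \in pleaves t -> pprofile t i = Some k.
Proof.
move=> ut tk; apply/pprofileP; split=> // m tm.
by rewrite (uniq_fst_inj ut tm tk).
Qed.

(** A variable that occurs once has its coefficient as its depth, so variable order and [coef t]
    determine the leaf sequence. The default 0 is not reached for variables of [t]. *)
Lemma star_only_pleaves (t : term 'I_n) : star_only t -> uniq (vars t) ->
  exists2 p, pterm p = t
    & pleaves p = [seq (Some i, odflt 0 (coef t i)) | i <- vars t].
Proof.
move=> /star_onlyP[p pE labels] uv; exists p => //.
pose h (l : option 'I_n) := (l, if l is Some i then odflt 0 (coef t i) else 0).
transitivity (map h (map Some (vars t))); last by rewrite -map_comp.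
rewrite -labels -map_comp.
rewrite map_id_in // => -[l k] pl /=.
have : l \in map Some (vars t) by rewrite -labels (map_f fst pl).
case/mapP=> i _ li; rewrite /h /= li -pE -pprofileE.
rewrite (@pprofile_uniq _ _ k) -?li // labels map_inj_uniq //; exact: Some_inj.
Qed.

(** Equal variable orders and equal coefficients give the same leaf sequence, hence the same plane
    tree. *)
Lemma full_linear_inj (s t : term 'I_n) :
  full_linear s -> full_linear t -> vars s = vars t ->
  term_op s = term_op t -> s = t.
Proof.
move=> /andP[ss ps] /andP[st pt] vst /term_op_coef cst.
have uv (r : term 'I_n) : perm_eq (vars r) (enum 'I_n) -> uniq (vars r).
  by move/perm_uniq->; rewrite enum_uniq.
have [p sE pE] := star_only_pleaves ss (uv _ ps).
have [q tE qE] := star_only_pleaves st (uv _ pt).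
by rewrite -sE -tE (@pleaves_inj p q) // pE qE cst vst.
Qed.

Definition dyadic_op (d : {ffun 'I_n -> nat}) : power Halg n -> Halg :=
  lin ([ffun i => Some (d i)] : power Halg n).

Lemma dyadic_op_inj : injective dyadic_op.
Proof.
move=> d e de.
have /ffunP h :
    [ffun i => Some (d i)] = [ffun i => Some (e i)] :> power Halg n.
  by apply: lin_inj => u; rewrite -/(dyadic_op d) de.
by apply/ffunP => i; have := h i; rewrite !ffunE => -[].
Qed.

Lemma dyadic_tree (d : {ffun 'I_n -> nat}) : dyadic_representations d ->
  exists t, perm_eq (pleaves t) [seq (Some i, d i) | i <- enum 'I_n].
Proof.
by move=> d1; apply: kraft_realize; rewrite big_map big_enum.
Qed.

Lemma full_linear_ops_dyadic :
  @full_linear_ops n = (dyadic_op @` @dyadic_representations n)%classic.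
Proof.
apply/seteqP; split=> [f [t /andP[st pt] ->]|_ [d d1 <-]].
- have uv : uniq (vars t) by rewrite (perm_uniq pt) enum_uniq.
  have [p pE leaves] := star_only_pleaves st uv.
  (* The leaf depths: the leaves correspond bijectively to the variables, so their weights sum to
     exactly 1. *)
  exists [ffun i => odflt 0 (coef t i)].
    rewrite /dyadic_representations /= -(kraft_pleaves p) leaves big_map.
    rewrite (perm_big _ pt) big_enum /=.
    by apply: eq_bigr => i _; rewrite ffunE.
  apply/funext => u; rewrite term_op_lin /dyadic_op; congr lin.
  apply/ffunP => i; rewrite !ffunE.
  have : (Some i, odflt 0 (coef t i)) \in pleaves p.
    by rewrite leaves; apply/mapP; exists i; rewrite // (perm_mem pt) mem_enum.
  move/(pprofile_uniq _) => <-; first by rewrite -pE -pprofileE.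
  rewrite leaves -map_comp map_inj_uniq // => x y; exact: Some_inj.
- have [t tE] := dyadic_tree d1.
  have labels : perm_eq [seq p.1 | p <- pleaves t] (map Some (enum 'I_n)).
    by rewrite (permPl (perm_map _ tE)) -map_comp.
  (* The tree has one leaf for each variable and no silent leaf, so its term is full-linear. *)
  exists (pterm t).
    rewrite /full_linear star_only_pterm -(all_map fst isSome).
    rewrite (perm_all _ labels) all_map.
    apply/andP; split; first by apply/allP.
    rewrite pterm_vars (permPl (perm_pmap _ tE)).
    by elim: (enum _) => //= i e; rewrite perm_cons.
  apply/funext => u; rewrite term_op_lin -pprofileE; congr lin.
  apply/ffunP => i; rewrite ffunE; symmetry; apply: pprofile_uniq.
    by rewrite (perm_uniq labels) map_inj_uniq ?enum_uniq //; exact: Some_inj.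
  by rewrite (perm_mem tE); apply/mapP; exists i; rewrite ?mem_enum.
Qed.

(** Each edge on the path to a leaf passes a sibling subtree with at least one more leaf. This
    bounds dyadic representations and makes them finite in number. *)
Lemma depth_lt_size t p : p \in pleaves t -> p.2 < size (pleaves t).
Proof.
have pos r : 0 < size (pleaves r).
  by elim: r => //= r1 IHr r2 _; rewrite size_map size_cat addn_gt0 IHr.
elim: t p => [l|s IHs t IHt] p /=; first by rewrite inE => /eqP ->.
case/mapP => q; rewrite mem_cat size_map size_cat => /orP[] qin -> /=.
  by rewrite -addn1 leq_add ?IHs.
by rewrite -add1n leq_add ?IHt.
Qed.

Lemma finite_dyadic_representations : finite_set (@dyadic_representations n).
Proof.
pose f (g : {ffun 'I_n -> 'I_n.+1}) := [ffun i => val (g i)].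
apply: (@sub_finite_set _ _ (f @` setT)%classic); last first.
  by apply: finite_image; exact: finite_finset.
(* The realizing tree has [n] leaves, so all depths are below [n] and [inord] preserves them. *)
move=> d /dyadic_tree[t tE]; exists [ffun i => inord (d i)] => //.
apply/ffunP => i; rewrite !ffunE /= inordK // ltnS ltnW //.
have : (Some i, d i) \in pleaves t.
  by rewrite (perm_mem tE); apply/mapP; exists i; rewrite ?mem_enum.
by move/depth_lt_size; rewrite (perm_size tE) size_map size_enum_ord.
Qed.

Lemma card_full_linear_ops : exists N,
  (@full_linear_ops n #= `I_N)%card /\ (@dyadic_representations n #= `I_N)%card.
Proof.
have [N dN] := finite_dyadic_representations; exists N; split=> //.
rewrite full_linear_ops_dyadic; apply: card_eq_trans dN.
by apply: inj_card_eq => d e _ _; exact: dyadic_op_inj.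
Qed.

End FullLinear.

Theorem theorem1p3 (n : nat) (hn : (1 <= n)%N) :
  (* (1) *)
  [/\ forall (T : ltree n) (u : power Halg n), eval T u = lin (profile T) u,
      forall (T : ltree n) (i : 'I_n) (k : nat),
        profile T i = Some k <->
        occurs_at T i k /\ (forall m : nat, occurs_at T i m -> (m <= k)%N),
      forall (T : ltree n) (i : 'I_n),
        profile T i = None <-> (forall m : nat, ~~ occurs_at T i m)
    & forall S T : ltree n,
        (forall u : power Halg n, eval S u = eval T u) <-> profile S = profile T]
  /\
  (* (2) *)
  (forall d : power Halg n,
     ((exists T : ltree n, profile T = d) <->
      (\sum_(i < n) kraft_weight (d i) <= 1)%R) /\
     ((\sum_(i < n) kraft_weight (d i) <= 1)%R ->
      ((exists T : ltree n, internal_root T /\ profile T = d) <->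
       (forall i : 'I_n, d i <> Some 0%N))))
  /\
  (* (3) *)
  ((forall d : power Halg n,
      exists Ts : seq (ltree n),
        [/\ Ts <> [::], join_profile Ts = d
          & forall u : power Halg n, join_eval Ts u = lin d u])
   /\
   (exists phi : term_ops n -> power Halg n,
      [/\ alg_hom phi, bijective phi
        & forall (f : term_ops n) (d : power Halg n),
            (forall u : power Halg n, op_of f u = lin d u) <-> phi f = d])
   /\
   free_in (variety Halg) (@proj_op n)
   /\
   free_in (variety Halg) (@basis_vec n)
   /\
   [/\ absorbing_zero (fset0 : languages n),
       absorbing_zero (None : empty_completion (power Halg n)),
       bihom (@language_profile n)
     & forall L : languages n,
         language_profile L = None <-> L = fset0]
   /\
   [/\ @unital_completion Halg Hhat HatIn,
       forall (U : ualg) (iota : Halg -> U), unital_completion iota ->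
         uone U <> uzero U /\ (forall a : Halg, iota a <> uone U),
       forall (U : ualg) (iota : power Halg n -> U), unital_completion iota ->
         uone U <> uzero U /\ (forall a : power Halg n, iota a <> uone U)
     & forall e : empty_completion (power Halg n), ~ is_unit e])
  /\
  (* (4) *)
  ((forall s t : term 'I_n,
      full_linear s -> full_linear t -> vars s = vars t -> s <> t ->
      term_op s <> term_op t)
   /\
   (exists N : nat,
      (@full_linear_ops n #= `I_N)%card /\
      (@dyadic_representations n #= `I_N)%card)).
Proof.
split; last split; last split.
- split; [exact: eval_lin | | exact: profileNP | exact: eval_profile].
  by move=> T i k; exact: pprofileP.
- by move=> d; split; [exact: profile_kraft | exact: profile_internal_root].
- split; first exact: join_profile_surj.
  split.
    exists (@op_coef n); split; [exact: op_coef_hom | exact: op_coef_bij |].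
    exact: op_coefE.
  split; first exact: free_term_ops.
  split; first exact: free_power.
  split.
    split; [exact: languages_absorbing | exact: empty_completion_absorbing | |].
      exact: language_profile_bihom.
    exact: language_profile_None.
  split; first exact: Hhat_unital.
  + move=> U iota hU; split.
      exact: (@unital_completion_distinct Halg U iota None (Some 0)
                (@hstar_neq0 None (Some 0)) hU).
    apply: (@unital_completion_new Halg) hU => a.
    by exists (Some 0); exact: hstar_neq0.
  + move=> U iota hU; split.
      apply: unital_completion_distinct hU.
      exact: (power_star0_neq (a := const (power Halg n)) hn).
    apply: unital_completion_new hU => a.
    by exists [ffun=> Some 0]; exact: power_star0_neq.
  (* The vector of zeros defeats every candidate: [None] absorbs it, and products in [power Halg n]
     have no zero coordinate. *)
  + case=> [a|] e1; have := (e1 (Some [ffun=> Some 0])).1 => // -[].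
    exact: power_star0_neq.
- split; last exact: card_full_linear_ops.
  by move=> s t fs ft v st /(full_linear_inj fs ft v).
Qed.
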